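(* For problem (P) with $\Phi_\lambda=\Phi_{+,\lambda}$: (i) every stationary point of (P) is a local minimizer of $F$; (ii) if $x^*$ is a local minimizer of $F$ with $F(x^* )<\infty$, and the Slater condition $$\{x:\ x\in\operatorname{ri}(\operatorname{dom}f),\ Ax\in\operatorname{ri}(\operatorname{dom}g),\ (Bx-b)_{\bar J_*}\le0\}\neq\emptyset$$ holds, where $J_*=\{i:(Bx^*-b)_i\ne0\}$, $\bar J_*=[r]\setminus J_*$, and ''$\operatorname{ri}$'' may be omitted for $f$ (resp. $g$) when $f$ (resp. $g$) is polyhedral, then $x^*$ is a stationary point of (P).
   Context: Let $f:\mathbb R^n\to(-\infty,\infty]$, $g:\mathbb R^m\to(-\infty,\infty]$ be proper, lsc and convex; $A\in\mathbb R^{m\times n}$, $B\in\mathbb R^{r\times n}$, $b\in\mathbb R^r$, $\lambda\in\mathbb R^r$, $\lambda>0$. $\Phi_{+,\lambda}(u)=\sum_{i=1}^r\lambda_i\mathbf 1_{\{u_i>0\}}$; problem (P) is $\min_x F(x)=f(x)+g(Ax)+\Phi_{+,\lambda}(Bx-b)$. $\partial$ denotes the limiting subdifferential (the convex subdifferential for convex functions); $\partial\Phi_{+,\lambda}(u)=\{z: z_i\in\mathbb R_+\text{ if }u_i=0,\ z_i=0\text{ otherwise}\}$. A point $x^*$ is a stationary point of (P) if $0\in\partial f(x^* )+A^\top\partial g(Ax^* )+B^\top\partial\Phi_{+,\lambda}(Bx^*-b)$. $\operatorname{ri}$ denotes relative interior. *)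

(* Defs.v *)
From HB Require Import structures.
From mathcomp Require Import all_boot all_order all_algebra.
From mathcomp Require Import all_classical all_reals.
Set Implicit Arguments. Unset Strict Implicit. Unset Printing Implicit Defensive.
Import Order.TTheory GRing.Theory Num.Theory.
Local Open Scope ring_scope.

Section Defs.
Variable R : realType.

Definition dotv n (u v : 'cV[R]_n) : R := (u^T *m v) ord0 ord0.
Definition vnorm2 n (u : 'cV[R]_n) : R := \sum_(i < n) (u i ord0) ^+ 2.

Definition dom n (f : 'cV[R]_n -> \bar R) : set 'cV[R]_n :=
  [set x | (f x < +oo)%E].

Definition proper_fun n (f : 'cV[R]_n -> \bar R) : Prop :=
  (exists x, (f x < +oo)%E) /\ (forall x, (-oo < f x)%E).

Definition lsc_fun n (f : 'cV[R]_n -> \bar R) : Prop :=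
  forall (x : 'cV[R]_n) (a : R), (a%:E < f x)%E ->
    exists2 e : R, (0 < e)%R &
      forall y, (vnorm2 (y - x) < e)%R -> (a%:E < f y)%E.

(* convexity (for functions never equal to -oo) *)
Definition convex_fun n (f : 'cV[R]_n -> \bar R) : Prop :=
  forall (x y : 'cV[R]_n) (t : R), (0 <= t <= 1)%R ->
    (f x < +oo)%E -> (f y < +oo)%E ->
    (f (t *: x + (1 - t) *: y)%R <= (t * fine (f x) + (1 - t) * fine (f y))%:E)%E.

Definition csubdiff n (f : 'cV[R]_n -> \bar R) (x : 'cV[R]_n) : set 'cV[R]_n :=
  [set v | (f x < +oo)%E /\
     forall y, ((fine (f x) + dotv v (y - x))%:E <= f y)%E].

Definition Phi_plus r (lam : 'cV[R]_r) (u : 'cV[R]_r) : R :=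
  \sum_(i < r) (if (0 < u i ord0)%R then lam i ord0 else 0%R).

(* its (limiting) subdifferential, as given in the paper *)
Definition subdiff_Phi_plus r (u : 'cV[R]_r) : set 'cV[R]_r :=
  [set z | forall i, if u i ord0 == 0%R then (0 <= z i ord0)%R else z i ord0 == 0%R].

Definition F_obj n m r (f : 'cV[R]_n -> \bar R) (g : 'cV[R]_m -> \bar R)
  (A : 'M[R]_(m, n)) (B : 'M[R]_(r, n)) (b lam : 'cV[R]_r) (x : 'cV[R]_n)
  : \bar R :=
  (f x + g (A *m x)%R + (Phi_plus lam (B *m x - b)%R)%:E)%E.

Definition stationary n m r (f : 'cV[R]_n -> \bar R) (g : 'cV[R]_m -> \bar R)
  (A : 'M[R]_(m, n)) (B : 'M[R]_(r, n)) (b : 'cV[R]_r) (x : 'cV[R]_n) : Prop :=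
  exists v w z, csubdiff f x v /\ csubdiff g (A *m x) w /\
    subdiff_Phi_plus (B *m x - b) z /\
    v + A^T *m w + B^T *m z = 0.

Definition local_min n (F : 'cV[R]_n -> \bar R) (xs : 'cV[R]_n) : Prop :=
  exists2 e : R, (0 < e)%R &
    forall x, (vnorm2 (x - xs) < e)%R -> (F xs <= F x)%E.

Definition aff_hull n (C : set 'cV[R]_n) : set 'cV[R]_n :=
  [set y | exists (k : nat) (p : 'I_k -> 'cV[R]_n) (c : 'I_k -> R),
     (forall j, C (p j)) /\ (\sum_(j < k) c j = 1)%R /\
     y = \sum_(j < k) c j *: p j].

Definition ri n (C : set 'cV[R]_n) : set 'cV[R]_n :=
  [set x | C x /\ exists2 e : R, (0 < e)%R &
     forall y, aff_hull C y -> (vnorm2 (y - x) < e)%R -> C y].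

(* polyhedral convex function: its epigraph is a finite intersection of
   closed half-spaces of R^n x R *)
Definition polyhedral_fun n (f : 'cV[R]_n -> \bar R) : Prop :=
  exists (k : nat) (a : 'I_k -> 'cV[R]_n) (beta gamma : 'I_k -> R),
    forall (x : 'cV[R]_n) (t : R),
      (f x <= t%:E)%E <-> (forall j, (dotv (a j) x + beta j * t <= gamma j)%R).

End Defs.

(* Main.v *)
(** Near a point, [Phi_plus] only jumps upwards at the active constraints, so a
    stationary point is a local minimizer and, conversely, a local minimizer
    globally minimizes the convex function [f + g \o A] over the polyhedron of
    the constraints active at it.  Lifted to [(x, s, y, t)], the latter problem
    minimizes the affine function [s + t] over [f x <= s], [g y <= t],
    [y = A x] and the active constraints.  A polyhedral epigraph is put among
    the affine constraints, any other one in the convex set [C]; the Slater point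
    is then in the relative interior of [C], which is what is needed for affine
    constraints to have Lagrange multipliers.  These are constructed one
    constraint at a time from suprema of difference quotients, with an algebraic
    notion of relative interior in place of topology. *)

Require Import Defs.
From HB Require Import structures.
From mathcomp Require Import all_boot all_order all_algebra.
From mathcomp Require Import all_classical all_reals.
From mathcomp Require Import ring lra.
Import Order.TTheory GRing.Theory Num.Theory.
Local Open Scope ring_scope.
Local Open Scope classical_set_scope.

(** * Relative cores of convex sets and multipliers for affine constraints *)

Section AffineMultipliers.
Variables (R : realType) (V : lmodType R).
Implicit Types (C : set V) (h l : V -> R).

Definition convex_set C := forall x y (t : R),
  0 <= t <= 1 -> C x -> C y -> C (t *: x + (1 - t) *: y).

Definition affine_fun h := forall x y (t : R),
  h (t *: x + (1 - t) *: y) = t * h x + (1 - t) * h y.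

(* For convex [C] in finite dimension this is the relative interior: every
   segment of [C] ending at [x] can be prolonged beyond [x] inside [C]. *)
Definition rel_core C (x : V) :=
  C x /\ forall z, C z -> exists2 t : R, 1 < t & C (t *: x + (1 - t) *: z).

Lemma affine_funD h l : affine_fun h -> affine_fun l ->
  affine_fun (fun x => h x + l x).
Proof. by move=> hh hl x y t; rewrite hh hl; ring. Qed.

Lemma affine_funZ (c : R) h : affine_fun h -> affine_fun (fun x => c * h x).
Proof. by move=> hh x y t; rewrite hh; ring. Qed.

Lemma affine_fun_sum (I : Type) (s : seq I) (l : I -> V -> R) :
  (forall i, affine_fun (l i)) -> affine_fun (fun x => \sum_(i <- s) l i x).
Proof.
move=> hl; elim: s => [|i s IH] x y t; first by rewrite !big_nil; ring.
by rewrite !big_cons hl IH; ring.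
Qed.

Lemma convex_setI_le0 C l : convex_set C -> affine_fun l ->
  convex_set (C `&` [set x | l x <= 0]).
Proof.
move=> hC hl x y t /andP[t0 t1] [Cx lx] [Cy ly]; split.
  by apply: hC => //; rewrite t0.
rewrite /= in lx ly *; rewrite hl; nra.
Qed.

Lemma convex_setI_eq0 C l : convex_set C -> affine_fun l ->
  convex_set (C `&` [set x | l x = 0]).
Proof.
move=> hC hl x y t ht [Cx lx] [Cy ly]; split; first exact: hC.
by rewrite /= in lx ly *; rewrite hl lx ly; ring.
Qed.

Lemma affine_convex_comb (x z : V) (a t : R) :
  a *: (t *: x + (1 - t) *: z) + (1 - a) *: x =
  (1 + a * (t - 1)) *: x + (1 - (1 + a * (t - 1))) *: z.
Proof.
rewrite scalerDr !scalerA addrAC -scalerDl; congr (_ *: _ + _ *: _); ring.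
Qed.

Lemma rel_coreI_le0 C l x : convex_set C -> affine_fun l ->
  rel_core C x -> l x < 0 -> rel_core (C `&` [set y | l y <= 0]) x.
Proof.
move=> hC hl [Cx xC] lx; split; first by split=> //=; exact: ltW.
move=> z [Cz lz]; rewrite /= in lz; have [t t1 Ct] := xC z Cz.
set p := t *: x + _ in Ct.
(* This [a] solves [a * |l p| = (1 - a) * (- l x)], so moving from [x] towards [p] by the fraction
   [a] keeps [l] nonpositive. *)
pose a := - l x / (`|l p| - l x).
have d0 : 0 < `|l p| - l x by have := normr_ge0 (l p); lra.
have a0 : 0 < a by rewrite divr_gt0 // oppr_gt0.
have a1 : a <= 1 by rewrite ler_pdivrMr //; have := normr_ge0 (l p); lra.
have aE : a * (`|l p| - l x) = - l x by rewrite mulrVK // unitfE gt_eqF.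
exists (1 + a * (t - 1)); first by nra.
rewrite -affine_convex_comb -/p; split; first by apply: hC => //; rewrite ltW.
rewrite /= hl; have := ler_norm (l p); nra.
Qed.

Lemma rel_coreI_eq0 C l x : affine_fun l ->
  rel_core C x -> l x = 0 -> rel_core (C `&` [set y | l y = 0]) x.
Proof.
move=> hl [Cx xC] lx; split=> // z [Cz lz]; rewrite /= in lz.
have [t t1 Ct] := xC z Cz; exists t => //; split => //=.
by rewrite hl lx lz; ring.
Qed.

Lemma rel_core_mid C x z : convex_set C -> rel_core C x -> C z ->
  rel_core C (2^-1 *: x + (1 - 2^-1) *: z).
Proof.
move=> hC [Cx xC] Cz; have h2 : 0 <= (2^-1 : R) <= 1 by lra.
split; first exact: hC.
move=> y Cy; have [t t1 Ct] := xC y Cy.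
have t0 : t + 1 != 0 by rewrite gt_eqF //; lra.
(* The line from [y] through the midpoint meets the segment from [z] to the prolonged point
   [t *: x + (1 - t) *: y] at this parameter. *)
exists (2 * t / (t + 1)); first by rewrite ltr_pdivlMr; lra.
have -> : (2 * t / (t + 1)) *: (2^-1 *: x + (1 - 2^-1) *: z) +
    (1 - 2 * t / (t + 1)) *: y =
    (t + 1)^-1 *: (t *: x + (1 - t) *: y) + (1 - (t + 1)^-1) *: z.
  rewrite !scalerDr !scalerA [RHS]addrAC.
  by congr (_ *: _ + _ *: _ + _ *: _); field.
apply: hC => //; rewrite invr_ge0 invf_le1; lra.
Qed.

(** The condition on [c] reads [- h / l <= c] where [l > 0] and [c <= h / - l] where [l < 0]. Each
    lower bound is below each upper bound, because a segment joining the two sides crosses [l = 0],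
    where [h >= 0]; so the supremum of the lower bounds works. *)
Lemma two_sided_multiplier C h l : convex_set C -> affine_fun h ->
  affine_fun l -> (exists2 z, C z & 0 < l z) -> (exists2 z, C z & l z < 0) ->
  (forall x, C x -> l x = 0 -> 0 <= h x) ->
  exists c : R, forall x, C x -> 0 <= h x + c * l x.
Proof.
move=> hC hh hl [zp Czp lzp] [zm Czm lzm] h0.
have cross z y : C z -> 0 < l z -> C y -> l y < 0 ->
    - h z / l z <= h y / - l y.
  move=> Cz lz Cy ly; have d0 : 0 < l z - l y by lra.
  (* The weight at which [l] vanishes on the segment from [y] to [z]. *)
  pose t := - l y / (l z - l y).
  have tE : t * (l z - l y) = - l y by rewrite mulrVK // unitfE gt_eqF.
  have t01 : 0 <= t <= 1.
    by rewrite divr_ge0 ?ler_pdivrMr /=; lra.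
  have := h0 _ (hC z y t t01 Cz Cy).
  rewrite hl hh => hge0; have hge := hge0 ltac:(by nra).
  rewrite ler_pdivrMr // mulrAC ler_pdivlMr ?oppr_gt0 //.
  suff : 0 <= (t * h z + (1 - t) * h y) * (l z - l y).
    have -> : (t * h z + (1 - t) * h y) * (l z - l y) =
      t * (l z - l y) * h z + ((l z - l y) - t * (l z - l y)) * h y by ring.
    rewrite tE; lra.
  by apply: mulr_ge0 => //; exact: ltW.
pose S := [set - h z / l z | z in [set z | C z /\ 0 < l z]].
have Subd y : C y -> l y < 0 -> ubound S (h y / - l y).
  by move=> Cy ly _ [z [Cz lz] <-]; exact: cross.
have S0 : S !=set0 by exists (- h zp / l zp), zp.
have hS : has_sup S by split=> //; exists (h zm / - l zm); exact: Subd.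
exists (sup S) => x Cx.
have [lx|lx|lx] := ltgtP (l x) 0.
- have : sup S <= h x / - l x by apply: ge_sup => //; exact: Subd.
  by rewrite ler_pdivlMr ?oppr_gt0 //; lra.
- have : - h x / l x <= sup S by apply: sup_upper_bound => //; exists x.
  by rewrite ler_pdivrMr //; lra.
- by rewrite lx mulr0 addr0; exact: h0.
Qed.

Lemma inequality_multiplier C h l : convex_set C -> affine_fun h ->
  affine_fun l -> (exists2 z, C z & l z < 0) ->
  (forall x, C x -> l x <= 0 -> 0 <= h x) ->
  exists2 c : R, 0 <= c & forall x, C x -> 0 <= h x + c * l x.
Proof.
move=> hC hh hl lneg h0.
have [lpos|nlpos] := pselect (exists2 z, C z & 0 < l z); last first.
  exists 0 => // x Cx; rewrite mul0r addr0; apply: h0 => //.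
  by rewrite leNgt; apply/negP => lx; apply: nlpos; exists x.
have [x Cx lx|c hc] := two_sided_multiplier C h l hC hh hl lpos lneg.
  by apply: h0; rewrite // lx.
have [c0|c0] := leP 0 c; first by exists c.
(* If [c < 0], then [h >= - c * l > 0] wherever [l > 0], so the multiplier 0 already works. *)
exists 0 => // x Cx; rewrite mul0r addr0; have [lx|lx] := leP (l x) 0.
  exact: h0.
have := hc x Cx; nra.
Qed.

(** Unless [l] vanishes on [C], prolonging a segment from a point with [l <> 0] beyond [z] reaches
    the opposite sign of [l], so both sides are inhabited. *)
Lemma equality_multiplier C h l z : convex_set C -> affine_fun h ->
  affine_fun l -> rel_core C z -> l z = 0 ->
  (forall x, C x -> l x = 0 -> 0 <= h x) ->
  exists c : R, forall x, C x -> 0 <= h x + c * l x.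
Proof.
move=> hC hh hl [Cz zC] lz h0.
have [l0|] := pselect (forall x, C x -> l x = 0).
  by exists 0 => x Cx; rewrite mul0r addr0; apply: h0 => //; exact: l0.
move=> /existsNP[x /not_implyP[Cx /eqP lx]].
have [t t1 Cp] := zC x Cx; set p := t *: z + _ in Cp.
have lp : l p = (1 - t) * l x by rewrite hl lz; ring.
move: lx; rewrite neq_lt => /orP[lx|lx].
  apply: two_sided_multiplier => //; last by exists x.
  by exists p => //; nra.
apply: two_sided_multiplier => //; first by exists x.
by exists p => //; nra.
Qed.

(* Lagrange multipliers for affine inequality constraints whose Slater point
   only lies in the relative interior of the abstract constraint [C].  If the
   first constraint [l i] is never strict on the feasible set, then a
   multiplier [c] of arbitrary sign is found on [C /\ l i = 0]; it is repaired
   by adding a large multiple of the induction hypothesis for the objective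
   [l i] itself. *)
Lemma affine_multipliers (I : eqType) (s : seq I) (l : I -> V -> R) C h z :
  uniq s -> convex_set C -> affine_fun h -> (forall i, affine_fun (l i)) ->
  rel_core C z -> (forall i, i \in s -> l i z <= 0) ->
  (forall x, C x -> (forall i, i \in s -> l i x <= 0) -> 0 <= h x) ->
  exists2 c : I -> R, (forall i, 0 <= c i) &
    forall x, C x -> 0 <= h x + \sum_(i <- s) c i * l i x.
Proof.
move=> us hC hh hl; elim: s us C h z hC hh => [|i s IH] /=.
  move=> _ C h z hC hh zC _ h0; exists (fun=> 0) => // x Cx.
  by rewrite big_nil addr0; exact: h0.
case/andP=> iNs us C h z hC hh zC lz h0.
have affS (c : I -> R) k : affine_fun k ->
    affine_fun (fun x => k x + \sum_(j <- s) c j * l j x).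
  move=> hk; apply: affine_funD => //.
  by apply: affine_fun_sum => j; exact: affine_funZ.
have lzs j : j \in s -> l j z <= 0.
  by move=> js; apply: lz; rewrite inE js orbT.
have sum_upd (a : R) (c : I -> R) x :
    \sum_(j <- i :: s) (if j == i then a else c j) * l j x =
    a * l i x + \sum_(j <- s) c j * l j x.
  rewrite big_cons eqxx; congr (_ + _); apply: eq_big_seq => j js.
  by case: eqP => // ji; rewrite -ji js in iNs.
(* If [l i] can be strict, [y] stays in the relative core after [l i <= 0] is absorbed into [C], and
   it is the strict point needed to release that constraint again. *)
have [[y yC [lys lyi]]|nst] := pselect (exists2 y, rel_core C y &
    (forall j, j \in s -> l j y <= 0) /\ l i y < 0).
  have [x [Cx lix] lx|c c0 hc] := IH us _ h y
      (convex_setI_le0 C _ hC (hl i)) hh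
      (rel_coreI_le0 C _ _ hC (hl i) yC lyi) lys.
    by apply: h0 => // j; rewrite inE => /orP[/eqP->//|]; exact: lx.
  have [||x Cx lx|a a0 ha] := inequality_multiplier C _ (l i) hC (affS c h hh).
  - exact: hl.
  - by exists y => //; case: yC.
  - by apply: hc.
  exists (fun j => if j == i then a else c j) => [j|x Cx]; first by case: ifP.
  by rewrite sum_upd addrCA addrA addrAC; have := ha x Cx; lra.
(* Otherwise the midpoint of [z] and [x] would be a strict point in the relative core. *)
have lige x : C x -> (forall j, j \in s -> l j x <= 0) -> 0 <= l i x.
  move=> Cx lx; rewrite leNgt; apply/negP => lix; apply: nst.
  exists (2^-1 *: z + (1 - 2^-1) *: x); first exact: rel_core_mid.
  split=> [j js|]; rewrite hl.
    by have := lx j js; have := lzs j js; lra.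
  by have := lz i (mem_head _ _); lra.
have liz : l i z = 0.
  apply/eqP; rewrite eq_le lz ?mem_head //= lige //; by case: zC.
have [x [Cx lix] lx|c c0 hc] := IH us _ h z
    (convex_setI_eq0 C _ hC (hl i)) hh
    (rel_coreI_eq0 C _ _ (hl i) zC liz) lzs.
  apply: h0 => // j; rewrite inE => /orP[/eqP->|]; last exact: lx.
  by rewrite lix.
have [|||x Cx lx|a ha] := equality_multiplier C _ (l i) z hC (affS c h hh).
- exact: hl.
- exact: zC.
- exact: liz.
- by apply: hc.
have [d d0 hd] := IH us C (l i) z hC (hl i) zC lzs lige.
exists (fun j => if j == i then `|a| + a else c j + `|a| * d j).
  move=> j; case: ifP => _; first by have := ler_norm (- a); rewrite normrN; lra.
  by rewrite addr_ge0 // mulr_ge0.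
move=> x Cx; rewrite sum_upd.
have -> : \sum_(j <- s) (c j + `|a| * d j) * l j x =
    \sum_(j <- s) c j * l j x + `|a| * \sum_(j <- s) d j * l j x.
  by rewrite mulr_sumr -big_split; apply: eq_bigr => j _; rewrite mulrDl mulrA.
have := ha x Cx; have := mulr_ge0 (normr_ge0 a) (hd x Cx); lra.
Qed.

End AffineMultipliers.

(** * Inner products and small perturbations of vectors *)

Section Vectors.
Variable R : realType.

Lemma dotvE n (u v : 'cV[R]_n) : dotv u v = \sum_i u i ord0 * v i ord0.
Proof. by rewrite /dotv mxE; apply: eq_bigr => i _; rewrite mxE. Qed.

Lemma dotvDl n (u v w : 'cV[R]_n) : dotv (u + v) w = dotv u w + dotv v w.
Proof. by rewrite /dotv linearD /= mulmxDl mxE. Qed.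

Lemma dotvDr n (u v w : 'cV[R]_n) : dotv w (u + v) = dotv w u + dotv w v.
Proof. by rewrite /dotv mulmxDr mxE. Qed.

Lemma dotvNl n (u v : 'cV[R]_n) : dotv (- u) v = - dotv u v.
Proof. by rewrite /dotv linearN /= mulNmx mxE. Qed.

Lemma dotvNr n (u v : 'cV[R]_n) : dotv u (- v) = - dotv u v.
Proof. by rewrite /dotv mulmxN mxE. Qed.

Lemma dotvZr n (c : R) (u v : 'cV[R]_n) : dotv u (c *: v) = c * dotv u v.
Proof. by rewrite /dotv -scalemxAr mxE. Qed.

Lemma dotv_trmx n m (A : 'M[R]_(m, n)) (w : 'cV[R]_m) (x : 'cV[R]_n) :
  dotv (A^T *m w) x = dotv w (A *m x).
Proof. by rewrite /dotv trmx_mul trmxK mulmxA. Qed.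

Lemma vnorm2Z n (c : R) (u : 'cV[R]_n) : vnorm2 (c *: u) = c ^+ 2 * vnorm2 u.
Proof.
by rewrite /vnorm2 mulr_sumr; apply: eq_bigr => i _; rewrite mxE exprMn.
Qed.

Lemma vnorm2_ge0 n (u : 'cV[R]_n) : 0 <= vnorm2 u.
Proof. by apply: sumr_ge0 => i _; exact: sqr_ge0. Qed.

Lemma vnorm2_scale_small n (u : 'cV[R]_n) (e : R) : 0 < e ->
  exists2 d : R, 0 < d & forall t, 0 < t < d -> vnorm2 (t *: u) < e.
Proof.
move=> e0; have N0 := vnorm2_ge0 _ u; set N := vnorm2 u in N0 *.
have N1 : 0 < 1 + N by lra.
exists (Num.min 1 (e / (1 + N))); first by rewrite lt_min ltr01 divr_gt0.
move=> t /andP[t0]; rewrite lt_min ltr_pdivlMr // => /andP[t1 te].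
rewrite vnorm2Z -/N expr2; nra.
Qed.

Lemma mulmx_entry_small n r (B : 'M[R]_(r, n)) (i : 'I_r) (c : R) : 0 < c ->
  exists2 e : R, 0 < e &
    forall d : 'cV[R]_n, vnorm2 d < e -> `|(B *m d) i ord0| < c.
Proof.
move=> c0; pose K := 1 + \sum_j `|B i j|.
have K0 : 0 < K by rewrite ltr_pwDl // sumr_ge0.
have cK : 0 < c / K by rewrite divr_gt0.
(* [vnorm2] is a squared norm, so this radius bounds each entry of [d] by [c / K]; the summand 1 in
   [K] keeps it positive and the final bound strict. *)
exists ((c / K) ^+ 2) => [|d hd]; first exact: exprn_gt0.
have dj j : `|d j ord0| <= c / K.
  rewrite -(@ler_pXn2r _ 2) ?nnegrE ?(ltW cK) // real_normK ?num_real //.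
  apply: le_trans (ltW hd); rewrite /vnorm2 (bigD1 j) //= lerDl.
  by apply: sumr_ge0 => k _; exact: sqr_ge0.
rewrite mxE; apply: le_lt_trans (ler_norm_sum _ _ _) _.
apply: (@le_lt_trans _ _ ((\sum_j `|B i j|) * (c / K))).
  by rewrite mulr_suml; apply: ler_sum => j _; rewrite normrM ler_wpM2l.
rewrite -[ltRHS](@mulrVK _ K) ?unitfE ?gt_eqF // [ltRHS]mulrC ltr_pM2r //.
by rewrite /K; lra.
Qed.

Lemma uniform_radius (I : finType) (P : I -> R -> Prop) :
  (forall i, exists2 e, 0 < e & forall d, d < e -> P i d) ->
  exists2 e, 0 < e & forall d, d < e -> forall i, P i d.
Proof.
move=> hP; have /boolp.choice[e he] : forall i, exists e : R,
    0 < e /\ forall d, d < e -> P i d.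
  by move=> i; have [e] := hP i; exists e.
exists (\big[Num.min/1]_i e i) => [|d hd i].
  by elim/big_rec: _ => // i x _ x0; rewrite lt_min x0 (he i).1.
apply: (he i).2; apply: lt_le_trans hd _.
by rewrite (bigD1 i) //= ge_min lexx.
Qed.

End Vectors.

(** * Epigraphs and their relative cores *)

Section Epigraphs.
Variables (R : realType) (n : nat).
Implicit Types (f : 'cV[R]_n -> \bar R).

(** [R^o] is the field as a module over itself, which makes the product a module. *)
Definition epi f : set ('cV[R]_n * R^o) := [set p | (f p.1 <= p.2%:E)%E].

Lemma proper_dom f x : proper_fun f -> dom f x -> f x = (fine (f x))%:E.
Proof. by case=> _ /(_ x) fx; rewrite /dom /= => fx'; rewrite fineK// fin_real// fx. Qed.

Lemma epi_dom f p : epi f p -> dom f p.1.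
Proof. by rewrite /epi /dom /= => /le_lt_trans; apply; exact: ltry. Qed.

Lemma epi_fine f p : proper_fun f -> epi f p -> fine (f p.1) <= p.2.
Proof.
move=> fp ep; have := ep; rewrite /epi /= (proper_dom f p.1 fp) ?lee_fin //.
exact: epi_dom.
Qed.

Lemma convex_epi f : proper_fun f -> convex_fun f -> convex_set _ _ (epi f).
Proof.
move=> fp fc p q t t01 ep eq; rewrite /epi /=.
apply: le_trans (fc _ _ _ t01 (epi_dom _ _ ep) (epi_dom _ _ eq)) _.
rewrite lee_fin; have := epi_fine _ _ fp ep; have := epi_fine _ _ fp eq.
have /andP[t0 t1] := t01; move=> h1 h2.
by apply: lerD; apply: ler_wpM2l => //; rewrite subr_ge0.
Qed.

Lemma convex_dom f : convex_fun f -> convex_set _ _ (dom f).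
Proof.
move=> fc x y t t01 fx fy; apply: le_lt_trans (fc _ _ _ t01 fx fy) _.
exact: ltry.
Qed.

(** A short prolongation beyond [x] stays in the affine hull and close to [x]. *)
Lemma ri_rel_core (C : set 'cV[R]_n) x : ri C x -> rel_core _ _ C x.
Proof.
case=> Cx [e e0 xC]; split=> // z Cz.
have [d d0 hd] := vnorm2_scale_small R n (x - z) e e0.
exists (1 + d / 2); first by lra.
apply: xC; last first.
  have -> : (1 + d / 2) *: x + (1 - (1 + d / 2)) *: z - x = (d / 2) *: (x - z).
    by apply/matrixP => i j; rewrite !mxE; ring.
  by apply: hd; lra.
exists 2%N, (fun j : 'I_2 => if j == ord0 then x else z),
  (fun j : 'I_2 => if j == ord0 then 1 + d / 2 else 1 - (1 + d / 2)).
split; first by move=> j; case: ifP.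
by rewrite !big_ord_recl !big_ord0 /= !addr0; split=> //; ring.
Qed.

Lemma rel_core_epi f x : proper_fun f -> convex_fun f ->
  rel_core _ _ (dom f) x ->
  rel_core _ ('cV[R]_n * R^o)%type (epi f) (x, fine (f x) + 1).
Proof.
move=> fp fc [fx xC]; split.
  by rewrite /epi /= {1}(proper_dom f x fp fx) lee_fin; lra.
move=> [z q] ez; have fz := epi_dom _ _ ez.
have [t t1 ft] := xC z fz; set y := t *: x + _ in ft.
(* At parameter [t] the prolonged point lies [D - 1] below the graph. Shrinking the prolongation by
   [a] turns this into [a * D - 1], up to convexity of [f], so [a * D <= 1] is what is needed. *)
pose D := fine (f y) - fine (f x) - (t - 1) * (fine (f x) + 1 - q).
have D0 : 0 < 1 + `|D| by have := normr_ge0 D; lra.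
pose a := (1 + `|D|)^-1.
have a0 : 0 < a by rewrite invr_gt0.
have a1 : a <= 1 by rewrite invf_le1 //; have := normr_ge0 D; lra.
have aE : a * (1 + `|D|) = 1 by rewrite mulVf // gt_eqF.
exists (1 + a * (t - 1)); first by nra.
rewrite /epi /= -affine_convex_comb -/y.
have a01 : 0 <= a <= 1 by rewrite a1 ltW.
apply: le_trans (fc _ _ _ a01 ft fx) _; rewrite lee_fin /GRing.scale /=.
have : a * D <= 1 by rewrite -aE ler_pM2l //; have := ler_norm D; lra.
rewrite /D; lra.
Qed.

(* Under either qualification, the epigraph is cut out by finitely many affine
   inequalities from a convex set having a feasible point above [x] in its
   relative interior. *)
Lemma qualified_epi f x : proper_fun f -> convex_fun f ->
  ri (dom f) x \/ (polyhedral_fun f /\ dom f x) ->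
  exists (C : set ('cV[R]_n * R^o)) (I : finType)
    (l : I -> 'cV[R]_n * R^o -> R) (s : R),
    [/\ convex_set _ _ C, forall i, affine_fun _ _ (l i),
        rel_core _ _ C (x, s), forall i, l i (x, s) <= 0 &
        forall p, epi f p <-> C p /\ forall i, l i p <= 0].
Proof.
move=> fp fc [xri|[[k [a [bt [gm fE]]]] fx]].
  exists (epi f), 'I_0, (fun _ _ => 0), (fine (f x) + 1); split.
  - exact: convex_epi.
  - by case.
  - by apply: rel_core_epi => //; exact: ri_rel_core.
  - by case.
  - by move=> p; split=> [ep|[]//]; split=> // -[].
(* With the whole space as [C] the relative core is everything, so a point of the graph itself will
   do. *)
exists setT, 'I_k, (fun j p => dotv (a j) p.1 + bt j * p.2 - gm j), (fine (f x)).
split=> //.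
- move=> j p q t; rewrite /= dotvDr !dotvZr /GRing.scale /=; ring.
- by split=> // z _; exists 2 => //; lra.
- by move=> j /=; rewrite subr_le0; apply: (fE _ _).1; rewrite -proper_dom.
- move=> p; rewrite /epi /= fE; split=> [h|[_ h] j].
    by split=> // j; rewrite subr_le0.
  by have := h j; rewrite subr_le0.
Qed.

End Epigraphs.

(** * Lagrange multipliers for the lifted convex problem *)

Lemma rel_core_setX (R : realType) (V W : lmodType R) (C : set V) (D : set W)
    x y : convex_set _ _ C -> convex_set _ _ D ->
  rel_core _ _ C x -> rel_core _ _ D y ->
  rel_core _ (V * W)%type (C `*` D) (x, y).
Proof.
move=> hC hD [Cx xC] [Dy yD]; split=> // -[z w] [/= Cz Dw].
have [t t1 Ct] := xC z Cz; have [u u1 Du] := yD w Dw.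
(* By convexity a prolongation can be shortened, so the smaller of the two factors serves both
   components. *)
have shrink (U : lmodType R) (E : set U) p q (c d : R) : convex_set _ _ E ->
    E p -> 1 < d <= c -> E (c *: p + (1 - c) *: q) ->
    E (d *: p + (1 - d) *: q).
  move=> hE Ep /andP[d1 dc] Ec; have c0 : 0 < c - 1 by lra.
  have cE : (d - 1) / (c - 1) * (c - 1) = d - 1.
    by rewrite mulrVK // unitfE gt_eqF.
  have := hE _ _ ((d - 1) / (c - 1)) _ Ec Ep.
  rewrite affine_convex_comb cE (_ : 1 + (d - 1) = d) ?subrKC //; apply.
  by rewrite divr_ge0 ?ler_pdivrMr; lra.
have m1 : 1 < Num.min t u by rewrite lt_min t1.
by exists (Num.min t u) => //; split=> /=;
  [apply: shrink Ct | apply: shrink Du]; rewrite // m1 ge_min lexx ?orbT.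
Qed.

(** The multiplier [w] of [y = A x] decouples [f] from [g]: the points [p] and [q] of the epigraphs
    vary independently, so freezing either one yields a subgradient inequality for the other
    function. *)
Lemma lagrange_multipliers (R : realType) (n m r : nat)
    (f : 'cV[R]_n -> \bar R) (g : 'cV[R]_m -> \bar R) (A : 'M[R]_(m, n))
    (l : 'I_r -> 'cV[R]_n -> R) (x0 : 'cV[R]_n) (v : R) :
  proper_fun f -> convex_fun f -> proper_fun g -> convex_fun g ->
  (forall i, affine_fun _ _ (l i)) ->
  ri (dom f) x0 \/ (polyhedral_fun f /\ dom f x0) ->
  ri (dom g) (A *m x0) \/ (polyhedral_fun g /\ dom g (A *m x0)) ->
  (forall i, l i x0 <= 0) ->
  (forall x, dom f x -> dom g (A *m x) -> (forall i, l i x <= 0) ->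
    v <= fine (f x) + fine (g (A *m x))) ->
  exists (w : 'cV[R]_m) (z : 'I_r -> R), (forall i, 0 <= z i) /\
    forall p q, epi _ _ f p -> epi _ _ g q ->
      v <= p.2 + q.2 + dotv w (A *m p.1 - q.1) + \sum_i z i * l i p.1.
Proof.
move=> fp fc gp gc hl fx0 gx0 lx0 hv.
have [Cf [If [lf [s [hCf alf sCf lfs fE]]]]] := qualified_epi _ _ _ _ fp fc fx0.
have [Cg [Ig [lg [t [hCg alg tCg lgt gE]]]]] := qualified_epi _ _ _ _ gp gc gx0.
pose V := (('cV[R]_n * R^o) * ('cV[R]_m * R^o))%type.
(* The equation [y = A x] enters as two opposite inequalities per coordinate; [w] is the difference
   of their multipliers. *)
pose L (k : (If + Ig) + (('I_m + 'I_m) + 'I_r)) (p : V) : R := match k with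
  | inl (inl i) => lf i p.1
  | inl (inr i) => lg i p.2
  | inr (inl (inl i)) => (A *m p.1.1 - p.2.1) i ord0
  | inr (inl (inr i)) => - (A *m p.1.1 - p.2.1) i ord0
  | inr (inr i) => l i p.1.1 end.
pose h (p : V) : R := p.1.2 + p.2.2 - v.
have ah : affine_fun R V h.
  by move=> p q a; rewrite /h /= /GRing.scale /=; ring.
have aE (i : 'I_m) : affine_fun R V (fun p => (A *m p.1.1 - p.2.1) i ord0).
  by move=> p q a; rewrite /= mulmxDr -!scalemxAr !mxE; ring.
have aL k : affine_fun R V (L k).
  case: k => [[i|i]|[[i|i]|i]] p q a /=.
  - exact: alf.
  - exact: alg.
  - exact: aE.
  - by rewrite aE; ring.
  - exact: hl.
have cC : convex_set R V (Cf `*` Cg).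
  move=> p q a a01 [Cp Dp] [Cq Dq]; split; [exact: hCf|exact: hCg].
have [k _|p [Cp Dp] Lp|c c0 hc] := affine_multipliers R V _
    (index_enum _) L (Cf `*` Cg) h ((x0, s), (A *m x0, t))
    (index_enum_uniq _) cC ah aL (rel_core_setX _ _ _ _ _ _ _ hCf hCg sCf tCg).
- by case: k => [[i|i]|[[i|i]|i]] //=; rewrite subrr mxE ?oppr0.
- have {}Lp k : L k p <= 0 by apply: Lp; rewrite mem_index_enum.
  have ep : epi _ _ f p.1 by apply/fE; split=> // i; exact: (Lp (inl (inl i))).
  have eq : epi _ _ g p.2 by apply/gE; split=> // i; exact: (Lp (inl (inr i))).
  have yE : p.2.1 = A *m p.1.1.
    apply/eqP; rewrite eq_sym -subr_eq0; apply/eqP/matrixP => i j.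
    rewrite ord1 [RHS]mxE; apply/eqP; rewrite eq_le -[X in _ && X]oppr_le0.
    by rewrite (Lp (inr (inl (inl i)))) (Lp (inr (inl (inr i)))).
  have /= := hv p.1.1 (epi_dom _ _ _ _ ep).
  rewrite -yE => /(_ (epi_dom _ _ _ _ eq) (fun i => Lp (inr (inr i)))).
  have := epi_fine _ _ _ _ fp ep; have := epi_fine _ _ _ _ gp eq.
  rewrite /h; lra.
pose w : 'cV[R]_m :=
  \col_i (c (inr (inl (inl i))) - c (inr (inl (inr i)))).
exists w, (fun i => c (inr (inr i))); split=> // p q ep eq.
have [Cp lp] := (fE p).1 ep; have [Dq lq] := (gE q).1 eq.
have := hc (p, q) (conj Cp Dq); rewrite !big_sumType /= /h /=.
have S1 : \sum_i c (inl (inl i)) * lf i p <= 0.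
  by apply: sumr_le0 => i _; rewrite mulr_ge0_le0.
have S2 : \sum_i c (inl (inr i)) * lg i q <= 0.
  by apply: sumr_le0 => i _; rewrite mulr_ge0_le0.
have -> : dotv w (A *m p.1 - q.1) =
    \sum_i c (inr (inl (inl i))) * (A *m p.1 - q.1) i ord0 +
    \sum_i c (inr (inl (inr i))) * - (A *m p.1 - q.1) i ord0.
  by rewrite dotvE -big_split; apply: eq_bigr => i _; rewrite mxE /=; ring.
lra.
Qed.

(** * Stationary points and local minimizers *)

Section Optimality.
Variables (R : realType) (n m r : nat).
Variables (f : 'cV[R]_n -> \bar R) (g : 'cV[R]_m -> \bar R).
Variables (A : 'M[R]_(m, n)) (B : 'M[R]_(r, n)) (b lam : 'cV[R]_r).
Hypotheses (fp : proper_fun f) (gp : proper_fun g).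
Hypothesis lam0 : forall i, 0 < lam i ord0.

Local Notation F := (F_obj f g A B b lam).
Local Notation Phi := (Phi_plus lam).

Lemma F_obj_fine x : dom f x -> dom g (A *m x) ->
  F x = (fine (f x) + fine (g (A *m x)) + Phi (B *m x - b))%:E.
Proof.
move=> fx gx; rewrite /F_obj {1}(proper_dom _ _ f x fp fx).
by rewrite {1}(proper_dom _ _ g _ gp gx) -!EFinD.
Qed.

Lemma F_obj_dom x : (F x < +oo)%E -> dom f x /\ dom g (A *m x).
Proof.
have := fp.2 x; have := gp.2 (A *m x); rewrite /F_obj /dom /=.
by case: (f x) => [a| |] //; case: (g _) => [c| |] // _ _ _; rewrite !ltry.
Qed.

(** The subgradient inequalities of [f] and [g] are global, the one of [Phi] holds near [xs], and
    their linear terms add up to zero. *)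
Lemma stationary_local_min xs : stationary f g A B b xs -> local_min F xs.
Proof.
case=> v [w [z [[fxs hv] [[gxs hw] [hz vwz]]]]].
set u := B *m xs - b in hz.
have [|e e0 he] := uniform_radius R 'I_r (fun i e => forall d : 'cV[R]_n,
  vnorm2 d = e -> (if 0 < u i ord0 then lam i ord0 else 0) +
    z i ord0 * (B *m d) i ord0 <=
    if 0 < u i ord0 + (B *m d) i ord0 then lam i ord0 else 0).
- move=> i; have := hz i; case: eqP => [ui zi|/eqP ui /eqP zi].
    (* Active index: a move [t > 0] gains the jump [lam i], which exceeds [z i * t] below this
       bound; the 1 covers [z i = 0]. *)
    have c0 : 0 < lam i ord0 / (1 + z i ord0) by rewrite divr_gt0 //; lra.
    have [e e0 he] := mulmx_entry_small R n r B i _ c0.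
    exists e => // c ce d dc; move: ce; rewrite -dc => /he; rewrite ui ltxx !add0r.
    rewrite ltr_pdivlMr; last by lra.
    set t := (B *m d) i ord0 => ht; have := ler_norm t.
    by case: ifP => [t0|/negbT]; rewrite -?leNgt; nra.
  (* Inactive index: a positive [u i] stays positive, and for a negative one the left side is 0. *)
  have c0 : 0 < `|u i ord0| by rewrite normr_gt0.
  have [e e0 he] := mulmx_entry_small R n r B i _ c0.
  exists e => // c ce d dc; move: ce; rewrite -dc => /he; rewrite zi mul0r addr0.
  set t := (B *m d) i ord0; have := ltW (lam0 i).
  case: (ltgtP 0 (u i ord0)) ui => // ui _ l0.
    rewrite (gtr0_norm ui) => ht; have := ler_norm (- t); rewrite normrN.
    by case: ifP => [//|/negbT]; rewrite -leNgt; lra.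
  by case: ifP.
exists e => // x hx; set d := x - xs in hx.
have hPhi : Phi u + dotv z (B *m d) <= Phi (B *m x - b).
  rewrite dotvE /Phi_plus -big_split; apply: ler_sum => i _.
  suff -> : (B *m x - b) i ord0 = u i ord0 + (B *m d) i ord0.
    exact: (he _ hx i d erefl).
  rewrite /d mulmxBr /u; move: (B *m x) (B *m xs) => p q; rewrite !mxE; ring.
rewrite (F_obj_fine _ fxs gxs) -/u.
have hle : (((fine (f xs) + dotv v d) +
    (fine (g (A *m xs)) + dotv w (A *m x - A *m xs)) +
    (Phi u + dotv z (B *m d)))%:E <= F x)%E.
  rewrite /F_obj 2!EFinD; apply: leeD; last by rewrite lee_fin.
  by apply: leeD; [exact: hv | exact: hw].
apply: le_trans hle; rewrite lee_fin -mulmxBr -/d.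
have : dotv (v + A^T *m w + B^T *m z) d = 0.
  by rewrite vwz /dotv trmx0 mul0mx mxE.
rewrite !dotvDl !dotv_trmx; lra.
Qed.

(** For small [t], negative coordinates stay nonpositive and zero ones do so by hypothesis, so no
    new penalty is incurred. *)
Lemma Phi_plus_segment xs x :
  (forall i, (B *m xs - b) i ord0 = 0 -> (B *m x - b) i ord0 <= 0) ->
  exists2 e : R, 0 < e & forall t, 0 < t < e ->
    Phi (B *m (t *: x + (1 - t) *: xs) - b) <= Phi (B *m xs - b).
Proof.
move=> hx; set u := B *m xs - b in hx *.
have [|e e0 he] := uniform_radius R 'I_r (fun i t => 0 < t ->
  u i ord0 <= 0 -> t * (B *m x - b) i ord0 + (1 - t) * u i ord0 <= 0).
  move=> i; set y := (B *m x - b) i ord0.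
  have [ui|ui|ui] := ltgtP (u i ord0) 0.
  - exists (- u i ord0 / (`|y| - u i ord0)).
      by rewrite divr_gt0; have := normr_ge0 y; lra.
    move=> t; rewrite ltr_pdivlMr; last by have := normr_ge0 y; lra.
    move=> ht t0 _; have := ler_norm y; nra.
  - by exists 1 => //; lra.
  - exists 1 => // t _ t0 _; rewrite ui mulr0 addr0.
    by have := hx i ui; rewrite -/y; nra.
exists e => // t /andP[t0 te]; apply: ler_sum => i _.
have -> : (B *m (t *: x + (1 - t) *: xs) - b) i ord0 =
    t * (B *m x - b) i ord0 + (1 - t) * u i ord0.
  rewrite /u mulmxDr -!scalemxAr; move: (B *m x) (B *m xs) => p q.
  by rewrite !mxE; ring.
have := he t te i t0; have := ltW (lam0 i).
by case: ifP; case: ifP => //; move=> /negbT; rewrite -leNgt; lra.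
Qed.

(** A short move towards [x] does not raise [Phi], so it cannot lower the convex part, and convexity
    carries this to [x]. *)
Lemma local_min_convex xs : convex_fun f -> convex_fun g ->
  local_min F xs -> (F xs < +oo)%E ->
  forall x, dom f x -> dom g (A *m x) ->
    (forall i, (B *m xs - b) i ord0 = 0 -> (B *m x - b) i ord0 <= 0) ->
    fine (f xs) + fine (g (A *m xs)) <= fine (f x) + fine (g (A *m x)).
Proof.
move=> fc gc [e e0 he] /F_obj_dom[fxs gxs] x fx gx hx.
have [d d0 hd] := vnorm2_scale_small R n (x - xs) e e0.
have [d' d'0 hd'] := Phi_plus_segment xs x hx.
pose t := Num.min (Num.min d d') 1 / 2.
have [t0 td td' t1] : [/\ 0 < t, t < d, t < d' & t < 1].
  have M0 : 0 < Num.min (Num.min d d') 1 by rewrite !lt_min d0 d'0 ltr01.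
  have : Num.min (Num.min d d') 1 <= Num.min (Num.min d d') 1 by [].
  rewrite {2}/Num.min !le_min => /andP[/andP[h1 h2] h3].
  by rewrite /t; split; lra.
have t01 : 0 <= t <= 1 by rewrite !ltW.
set y := t *: x + (1 - t) *: xs in hd'.
have AyE : A *m y = t *: (A *m x) + (1 - t) *: (A *m xs).
  by rewrite mulmxDr -!scalemxAr.
have fy := convex_dom _ _ f fc _ _ _ t01 fx fxs.
have gy := convex_dom _ _ g gc _ _ _ t01 gx gxs.
rewrite -AyE in gy.
have := he y; rewrite (F_obj_fine _ fxs gxs) (F_obj_fine _ fy gy) lee_fin.
have -> : y - xs = t *: (x - xs).
  by apply/matrixP => i j; rewrite !mxE; ring.
move=> /(_ (hd t _)); rewrite t0 td => /(_ isT).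
have := hd' t; rewrite t0 td' => /(_ isT).
have := fc _ _ _ t01 fx fxs; rewrite -/y (proper_dom _ _ f y fp fy) lee_fin.
have := gc _ _ _ t01 gx gxs; rewrite -AyE (proper_dom _ _ g _ gp gy) lee_fin.
move=> h1 h2 h3 h4.
have : 0 <= t * (fine (f x) + fine (g (A *m x)) -
                 (fine (f xs) + fine (g (A *m xs)))) by lra.
by rewrite pmulr_rge0 // subr_ge0.
Qed.

Lemma local_min_stationary xs x0 : convex_fun f -> convex_fun g ->
  local_min F xs -> (F xs < +oo)%E ->
  ri (dom f) x0 \/ (polyhedral_fun f /\ dom f x0) ->
  ri (dom g) (A *m x0) \/ (polyhedral_fun g /\ dom g (A *m x0)) ->
  (forall i, (B *m xs - b) i ord0 = 0 -> (B *m x0 - b) i ord0 <= 0) ->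
  stationary f g A B b xs.
Proof.
move=> fc gc xsmin Fxs fx0 gx0 hx0; have [fxs gxs] := F_obj_dom _ Fxs.
have gmin := local_min_convex xs fc gc xsmin Fxs.
pose u := B *m xs - b.
(* Inactive constraints become the trivial constraint 0, which keeps the index type ['I_r]. *)
pose l i x := if u i ord0 == 0 then (B *m x - b) i ord0 else 0.
have al i : affine_fun R _ (l i).
  move=> x y t; rewrite /l; case: ifP => _; last by ring.
  rewrite mulmxDr -!scalemxAr; move: (B *m x) (B *m y) => p q.
  by rewrite !mxE; ring.
have [||w [z [z0 hwz]]] := lagrange_multipliers R n m r f g A l x0
  (fine (f xs) + fine (g (A *m xs))) fp fc gp gc al fx0 gx0.
- by move=> i; rewrite /l; case: eqP => // /hx0.
- move=> x fx gx lx; apply: gmin => // i /eqP ui.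
  by have := lx i; rewrite /l ui.
pose Z : 'cV[R]_r := \col_i (if u i ord0 == 0 then z i else 0).
have sumE x : \sum_i z i * l i x = dotv Z (B *m (x - xs)).
  rewrite dotvE; apply: eq_bigr => i _; rewrite /l [Z _ _]mxE.
  case: eqP => ui; rewrite ?mulr0 ?mul0r //; congr (_ * _).
  rewrite mulmxBr; move: ui; rewrite /u.
  move: (B *m x) (B *m xs) => p q; rewrite !mxE; lra.
have exs : epi _ _ f (xs, fine (f xs)) by rewrite /epi /= -proper_dom.
have egs : epi _ _ g (A *m xs, fine (g (A *m xs))) by rewrite /epi /= -proper_dom.
(* The first vector is forced by the stationarity equation. It is a subgradient of [f] by freezing
   [q] above [A xs], and [w] one of [g] by freezing [p] above [xs]. *)
exists (- (A^T *m w + B^T *m Z)), w, Z; split; last split; last split.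
- split=> // y; have := fp.2 y.
  case fy : (f y) => [q| |] // _; last by rewrite leey.
  have ey : epi _ _ f (y, q) by rewrite /epi /= fy.
  have := hwz _ _ ey egs; rewrite /= sumE lee_fin dotvNl dotvDl !dotv_trmx.
  rewrite -mulmxBr; lra.
- split=> // y; have := gp.2 y.
  case gy : (g y) => [q| |] // _; last by rewrite leey.
  have ey : epi _ _ g (y, q) by rewrite /epi /= gy.
  have := hwz _ _ exs ey; rewrite /= sumE subrr mulmx0 lee_fin.
  rewrite -(opprB y) dotvNr (_ : dotv Z 0 = 0); first by lra.
  by rewrite /dotv mulmx0 mxE.
- by move=> i; rewrite -/u [Z _ _]mxE; case: eqP.
- by rewrite -addrA addNr.
Qed.

End Optimality.

Theorem mainTheorem11 (R : realType) (n m r : nat)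
  (f : 'cV[R]_n -> \bar R) (g : 'cV[R]_m -> \bar R)
  (A : 'M[R]_(m, n)) (B : 'M[R]_(r, n)) (b lam : 'cV[R]_r)
  (hfp : proper_fun f) (hfl : lsc_fun f) (hfc : convex_fun f)
  (hgp : proper_fun g) (hgl : lsc_fun g) (hgc : convex_fun g)
  (hlam : forall i, (0 < lam i ord0)%R) :
  (forall xs : 'cV[R]_n,
     stationary f g A B b xs -> local_min (F_obj f g A B b lam) xs) /\
  (forall xs : 'cV[R]_n,
     local_min (F_obj f g A B b lam) xs ->
     (F_obj f g A B b lam xs < +oo)%E ->
     (exists x : 'cV[R]_n,
        (ri (dom f) x \/ (polyhedral_fun f /\ dom f x)) /\
        (ri (dom g) (A *m x) \/ (polyhedral_fun g /\ dom g (A *m x))) /\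
        (forall i : 'I_r, (B *m xs - b) i ord0 = 0%R -> ((B *m x - b) i ord0 <= 0)%R)) ->
     stationary f g A B b xs).
Proof.
split=> xs; first exact: stationary_local_min.
by move=> xsmin Fxs [x0 [fx0 [gx0 hx0]]]; exact: local_min_stationary hx0.
Qed.
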